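(* Let $(G,\tau)$ be a paratopological group, let $\tau^{-1}=\{U^{-1}:U\in\tau\}$ be the conjugate topology, and let $\Delta_G=\{(x,x):x\in G\}$ be the diagonal, regarded as a subspace of the product space $(G,\tau^{-1})\times(G,\tau)$. (a) If $\Delta_G$ is weakly compact-bounded, then $(G,\tau)$ is a topological group and is weakly compact-bounded. (b) If $\Delta_G$ is compact-bounded, then $(G,\tau)$ is a topological group and is compact-bounded.
   Context: All topological spaces (in particular all paratopological and topological groups) are assumed to be Hausdorff. A paratopological group is a group with a topology for which multiplication is jointly continuous. A space $X$ is compact-bounded if for every countable family $\mathcal U$ of non-empty open subsets of $X$ there is a compact $K\subset X$ which meets each element of $\mathcal U$. A space $X$ is weakly compact-bounded if for every infinite countable family $\mathcal U$ of non-empty open subsets of $X$ there is a compact $K\subset X$ which meets infinitely many elements of $\mathcal U$. *)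

(* Defs.v *)
From HB Require Import structures.
From mathcomp Require Import all_boot monoid.
From mathcomp Require Import all_classical topology.

Set Implicit Arguments.
Unset Strict Implicit.
Unset Printing Implicit Defensive.

Local Open Scope classical_set_scope.
Local Open Scope group_scope.

(* A group with an arbitrary topology; compatibility is imposed separately by
   the two predicates below, which both include the Hausdorff axiom. *)
#[short(type="groupWithTopologyType")]
HB.structure Definition GroupWithTopology := {G of Group G & Topological G}.

Definition paratopological_group (G : groupWithTopologyType) : Prop :=
  hausdorff_space G /\ continuous (fun xy : G * G => xy.1 * xy.2).

Definition topological_group (G : groupWithTopologyType) : Prop :=
  paratopological_group G /\ continuous (fun x : G => x^-1).

(* The carrier of [G] with the topology tau^-1 = {U^-1 : U in tau}. *)
Definition conjugate (G : groupWithTopologyType) : Type := G.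

Section ConjugateTopology.
Variable G : groupWithTopologyType.

HB.instance Definition _ := Choice.on (conjugate G).

Definition conjugate_open : set (set (conjugate G)) :=
  [set [set x^-1 | x in U] | U in (open : set (set G))].

Local Lemma inv_imageE (U : set G) :
  [set x^-1 | x in U] = [set x | U x^-1].
Proof.
apply/seteqP; split=> [_ [x Ux <-]/=|x/= Ux]; first by rewrite invgK.
by exists x^-1 => //; rewrite invgK.
Qed.

Local Lemma conjugate_openT : conjugate_open [set: conjugate G].
Proof. by exists setT; [exact: openT | rewrite inv_imageE]. Qed.

Local Lemma conjugate_openI : setI_closed conjugate_open.
Proof.
move=> _ _ [U oU <-] [V oV <-]; exists (U `&` V); first exact: openI.
by rewrite !inv_imageE.
Qed.

Local Lemma conjugate_open_bigU (I : Type) (f : I -> set (conjugate G)) :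
  (forall i, conjugate_open (f i)) -> conjugate_open (\bigcup_i f i).
Proof.
move=> fo; exists (\bigcup_i [set x : G | f i x^-1]).
  apply: bigcup_open => i _; have [U oU <-] := fo i.
  rewrite inv_imageE (_ : [set _ | _] = U)//.
  by apply/seteqP; split=> x /=; rewrite invgK.
rewrite inv_imageE; apply/seteqP; split=> x [i _ /=]; last by exists i; rewrite //= invgK.
by rewrite invgK; exists i.
Qed.

HB.instance Definition _ := isOpenTopological.Build (conjugate G)
  conjugate_openT conjugate_openI conjugate_open_bigU.

End ConjugateTopology.

Definition compact_bounded (X : topologicalType) : Prop :=
  forall UU : set (set X), countable UU ->
    (forall U, UU U -> open U /\ U !=set0) ->
    exists K : set X, compact K /\ forall U, UU U -> K `&` U !=set0.

Definition weakly_compact_bounded (X : topologicalType) : Prop :=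
  forall UU : set (set X), countable UU -> infinite_set UU ->
    (forall U, UU U -> open U /\ U !=set0) ->
    exists K : set X,
      compact K /\ infinite_set [set U | UU U /\ K `&` U !=set0].

(* The product topology on [conjugate G * G] induces, through the library's
   topology on [set_type], the subspace topology on the diagonal. *)
Definition conjugate_diagonal (G : groupWithTopologyType) :
    set (conjugate G * G) :=
  [set (x, x) | x in [set: G]].
Arguments conjugate_diagonal : clear implicits.

(* Main.v *)
(* If inversion were discontinuous at 1, choose neighbourhoods U_0, U_1, ... of 1
   with U_{n+1}^2 in U_n and x_n in U_{n+2} with x_n^-1 not in U_0, and put
   y_n = x_0 ... x_{n-1}. The diagonal carries the join of the topologies tau and
   tau^-1, and its weak compact-boundedness makes it precompact enough that
   y_m^-1 y_n lies in U_1 for some n < m. Then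
   x_n^-1 = (y_{n+1}^-1 y_m) (y_m^-1 y_n) lies in U_1^2, hence in U_0, a
   contradiction. Boundedness of G itself follows by projecting the diagonal
   onto (G, tau). *)

Require Import Defs.
From HB Require Import structures.
From mathcomp Require Import all_boot monoid.
From mathcomp Require Import all_classical topology.

Set Implicit Arguments.
Unset Strict Implicit.
Unset Printing Implicit Defensive.

Local Open Scope classical_set_scope.
Local Open Scope group_scope.

Section BoundednessTransfer.
Variables (X Y : topologicalType) (f : X -> Y).
Hypotheses (cf : continuous f) (sf : forall y, exists x, f x = y).

Lemma preimage_surj_nonempty (U : set Y) :
  open U /\ U !=set0 -> open (f @^-1` U) /\ f @^-1` U !=set0.
Proof.
move=> [oU [y Uy]]; split; first by apply: open_comp => // x _; exact: cf.
by have [x fx] := sf y; exists x; rewrite /= fx.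
Qed.

Lemma compact_image_continuous (K : set X) : compact K -> compact (f @` K).
Proof. by apply: continuous_compact; exact: continuous_subspaceT. Qed.

Lemma compact_bounded_image : compact_bounded X -> compact_bounded Y.
Proof.
move=> bX UU cUU oUU.
have [|_ [U UUU <-]|K [cK KU]] := bX [set f @^-1` U | U in UU].
- exact: card_le_trans (card_image_le _ _) _.
- exact/preimage_surj_nonempty/oUU.
- exists (f @` K); split; first exact: compact_image_continuous.
  move=> U UUU; have [|x [Kx Ux]] := KU (f @^-1` U); first by exists U.
  by exists (f x); split=> //; exists x.
Qed.

Lemma weakly_compact_bounded_image :
  weakly_compact_bounded X -> weakly_compact_bounded Y.
Proof.
move=> bX UU cUU iUU oUU.
have [|||K [cK KU]] := bX [set f @^-1` U | U in UU].
- exact: card_le_trans (card_image_le _ _) _.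
(* As [f] is onto, images undo preimages, so distinct sets of [UU] have distinct preimages and the
   pulled-back family stays infinite. *)
- move=> /(finite_image (fun A => f @` A)) fin; apply: iUU.
  apply: sub_finite_set fin => U UUU.
  exists (f @^-1` U); [by exists U | apply: image_preimage].
  by rewrite -subTset => y _; have [x fx] := sf y; exists x.
- by move=> _ [U UUU <-]; exact/preimage_surj_nonempty/oUU.
- exists (f @` K); split; first exact: compact_image_continuous.
  move=> /(finite_image (fun A => f @^-1` A)) fin; apply: KU.
  apply: sub_finite_set fin => _ [[U UUU <-] [x [Kx Ux]]].
  by exists U => //; split=> //; exists (f x); split=> //; exists x.
Qed.

End BoundednessTransfer.

Lemma compact_bounded_weakly (X : topologicalType) :
  compact_bounded X -> weakly_compact_bounded X.
Proof.
move=> bX UU cUU iUU oUU; have [K [cK KU]] := bX UU cUU oUU.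
exists K; split=> //; apply: sub_infinite_set iUU => U UUU.
by split=> //; exact: KU.
Qed.

Section Paratopological.
Variables (G : groupWithTopologyType).
Hypothesis cmul : continuous (fun xy : G * G => xy.1 * xy.2).

Lemma continuous_mulgl (a : G) : continuous (fun x : G => a * x).
Proof.
move=> x; apply: (@continuous_comp G (G * G)%type G (fun x => (a, x)) (fun xy => xy.1 * xy.2));
  last exact: cmul.
by apply: cvg_pair; [exact: cvg_cst|exact: cvg_id].
Qed.

Lemma continuous_mulgr (a : G) : continuous (fun x : G => x * a).
Proof.
move=> x; apply: (@continuous_comp G (G * G)%type G (fun x => (x, a)) (fun xy => xy.1 * xy.2));
  last exact: cmul.
by apply: cvg_pair; [exact: cvg_id|exact: cvg_cst].
Qed.

Lemma nbhs1_square (U : set G) : nbhs 1 U ->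
  exists2 V, nbhs 1 V & forall x y, V x -> V y -> U (x * y).
Proof.
move=> U1; have /= := @cmul (1, 1) U; rewrite mulg1 => /(_ U1).
move=> [[A B] /= [A1 B1] AB]; exists (A `&` B); first exact: filterI.
by move=> x y [Ax _] [_ By]; exact: (AB (x, y)).
Qed.

(** Translations are continuous, and writing x^-1 as (a^-1 x)^-1 a^-1 moves the point a to 1. *)
Lemma continuous_invg_at1 :
  (fun x : G => x^-1) @ (1 : G) --> (1 : G) -> continuous (fun x : G => x^-1).
Proof.
move=> inv1 a.
have shift : (fun x : G => x^-1) = (fun x => (a^-1 * x)^-1 * a^-1).
  by apply/funext => x; rewrite invgM invgK mulgK.
have la : (fun x => a^-1 * x) @ a --> (1 : G).
  by rewrite -(mulVg a); exact: continuous_mulgl.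
have ia : (fun x => (a^-1 * x)^-1) @ a --> (1 : G) by exact: cvg_comp la inv1.
have := cvg_comp _ _ ia (@continuous_mulgr a^-1 1).
by rewrite mul1g /comp -shift.
Qed.

Section WeaklyCompactBoundedCover.
Variables (X : topologicalType) (p : X -> G).
Hypotheses (sp : forall g, exists x, p x = g).
Hypotheses (cp : continuous p) (cVp : continuous (fun x => (p x)^-1)).
Hypothesis bX : weakly_compact_bounded X.

(** The first condition pulls back a tau-open set and the second a tau^-1-open one; [cp] and [cVp]
    make the topology of [X] fine enough for both. *)
Lemma open_two_sided (V : set G) (g : G) : open V ->
  open [set x | V (g^-1 * p x) /\ V ((p x)^-1 * g)].
Proof.
move=> oV; apply: openI.
  apply: (@open_comp _ _ (fun x => g^-1 * p x)) => // x _.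
  by apply: (@continuous_comp X G G p (fun h => g^-1 * h));
    [exact: cp|exact: continuous_mulgl].
apply: (@open_comp _ _ (fun x => (p x)^-1 * g)) => // x _.
by apply: (@continuous_comp X G G (fun x => (p x)^-1) (fun h => h * g));
  [exact: cVp|exact: continuous_mulgr].
Qed.

Lemma sequence_returns (U : set G) (y : nat -> G) : nbhs 1 U ->
  exists n m, (n < m)%N /\ U ((y m)^-1 * y n).
Proof.
move=> U1; apply: contrapT => noret.
have {}noret n m : (n < m)%N -> ~ U ((y m)^-1 * y n).
  by move=> nm Unm; apply: noret; exists n, m.
have [W W1 WU] := nbhs1_square U1; have [V' V'1 VW] := nbhs1_square W1.
pose V := interior V'.
have V1 : V 1 by [].
have oV : open V by exact: open_interior.
have VU a b c d : V a -> V b -> V c -> V d -> U (a * b * (c * d)).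
  by move=> Va Vb Vc Vd; apply: WU; apply: VW; exact: interior_subset.
(* The sets [N (y n)] are pairwise distinct, and a compact set
   meeting infinitely many of them provides a cluster point [z] with [N (p z)]
   meeting two of them. *)
pose N g := [set x | V (g^-1 * p x) /\ V ((p x)^-1 * g)].
have Ng g x : p x = g -> N g x by move=> <-; rewrite /N /= mulVg.
(* If the sets agree for n < m, a point over y_n lies in [N (y m)], so y_m^-1 y_n is in [V], hence
   in [U]. *)
have N_inj n m : N (y n) = N (y m) -> n = m.
  wlog nm : n m / (n < m)%N.
    by move=> H E; have [/H|/H|//] := ltngtP n m; [exact|move=> /(_ (esym E))].
  move=> E; exfalso; apply: (noret n m nm).
  have [x px] := sp (y n); have := Ng _ _ px; rewrite E => -[Vx _].
  by have := VU _ _ _ _ Vx V1 V1 V1; rewrite px !mulg1.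
have [|||K [cK KN]] := bX (UU := range (N \o y)).
- exact: card_le_trans (card_image_le _ _) _.
- move=> fin; apply: infinite_nat; rewrite -(preimage_range (N \o y)).
  by apply: finite_preimage fin => n m _ _; exact: N_inj.
- move=> _ [n _ <-]; split; first exact: open_two_sided.
  by have [x px] := sp (y n); exists x; exact: Ng.
(* Otherwise [K] would meet only sets of index below [n], which are finitely many. *)
have freq n : exists kt : nat * X, [/\ (n <= kt.1)%N, K kt.2 & N (y kt.1) kt.2].
  apply: contrapT => none; apply: KN.
  apply: (@sub_finite_set _ _ ((N \o y) @` `I_n)); last exact/finite_image/finite_II.
  move=> _ [[m _ <-] [x [Kx Nx]]]; exists m => //=.
  by rewrite ltnNge; apply/negP => nm; apply: none; exists (m, x).
have [s sP] := choice freq.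
have [|z [Kz cz]] := cK ((fun n => (s n).2) @ \oo) _.
  by exists 0%N => // n _; have [] := sP n.
have oNz : nbhs z (N (p z)).
  by apply: open_nbhs_nbhs; split; [exact: open_two_sided|exact: Ng].
have hit n : exists2 m, (n <= m)%N & N (p z) (s m).2.
  have [|x [[m /= nm <-] Nx]] := cz ((fun m => (s m).2) @` [set m | (n <= m)%N]) _ _ oNz.
    by exists n => // m /= nm; exists m.
  by exists m.
(* Let t and s be the points chosen at stages i and j, near y_n and y_m. Starting the second search
   past n forces n < m. Identifying points of [X] with their images, y_m^-1 y_n = (y_m^-1 s)(s^-1
   z)(z^-1 t)(t^-1 y_n), with all four factors in [V]. *)
have [i _ [zt _]] := hit 0%N; have [_ _ [_ tn]] := sP i.
have [j ij [_ sz]] := hit (s i).1.+1; have [jm _ [ms _]] := sP j.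
apply: (noret (s i).1 (s j).1); first exact: leq_trans jm.
by have := VU _ _ _ _ ms sz zt tn; rewrite !mulgA !mulgK.
Qed.

Lemma continuous_invg_cover : continuous (fun x : G => x^-1).
Proof.
apply: continuous_invg_at1 => U U1; apply: contrapT => nU.
(* Keeping [nbhs 1 V] under the existential makes the choice functions [g] and [h] total; their
   values elsewhere are junk. *)
have sq V : exists V' : set G, nbhs 1 V ->
    nbhs 1 V' /\ (forall x y, V' x -> V' y -> V (x * y)).
  have [/nbhs1_square [V' ? ?]|] := pselect (nbhs (1 : G) V); first by exists V'.
  by exists V.
have [g gP] := choice sq.
have bad V : exists x : G, nbhs 1 V -> V x /\ ~ U x^-1.
  have [V1|] := pselect (nbhs (1 : G) V); last by exists 1.
  apply: contrapT => none; apply: nU; rewrite /nbhs /=.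
  apply: filterS V1 => x Vx; apply: contrapT => Ux.
  by apply: none; exists x.
have [h hP] := choice bad.
pose V n := iter n g U.
have V1 n : nbhs 1 (V n) by elim: n => //= n /gP[].
have VV n a b : V n.+1 a -> V n.+1 b -> V n (a * b) by apply: (gP _ (V1 n)).2.
have decr n a : V n.+1 a -> V 1%N a.
  elim: n => // n IH Va; apply: IH; rewrite -[a]mulg1; apply: VV => //.
  exact: nbhs_singleton.
pose x n := h (V n.+2).
have Vx n : V n.+2 (x n) by exact: (hP _ (V1 _)).1.
pose y := fix y n := if n is n'.+1 then y n' * x n' else 1.
have yS n : (y n)^-1 * y n.+1 = x n by rewrite /= mulKg.
(* This is the product of k consecutive terms from x_n on: x_n and, by induction, the remaining
   product both lie in [V n.+2], which costs one level. *)
have Vy n k : V n.+1 ((y n)^-1 * y (n + k)%N).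
  elim: k n => [|k IH] n; first by rewrite addn0 mulVg; exact: nbhs_singleton.
  have -> : (y n)^-1 * y (n + k.+1)%N = x n * ((y n.+1)^-1 * y (n.+1 + k)%N).
    by rewrite addnS -addSn -yS -mulgA mulVKg.
  exact: VV.
have [n [m [nm ret]]] := sequence_returns y (V1 1%N).
have [_] := hP _ (V1 n.+2); apply; rewrite -/(x n).
have -> : (x n)^-1 = ((y n.+1)^-1 * y m) * ((y m)^-1 * y n).
  by rewrite -yS invgM invgK -mulgA mulVKg.
apply: (VV 0%N) => //.
(* Since n + 1 <= m, the first factor is a block of terms starting at x_{n+1}, possibly empty. *)
by apply: (decr n.+1); rewrite -(subnKC nm).
Qed.

End WeaklyCompactBoundedCover.
End Paratopological.

Section Diagonal.
Variable G : groupWithTopologyType.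
Local Notation D := (set_type (conjugate_diagonal G)).

Definition diagonal_point (d : D) : G := (set_val d).2.

Lemma continuous_diagonal_val : continuous (set_val : D -> conjugate G * G).
Proof. exact: initial_continuous. Qed.

Lemma diagonal_point_surj (g : G) : exists d, diagonal_point d = g.
Proof.
have gD : (g, g) \in conjugate_diagonal G by rewrite inE; exists g.
by exists (SigSub gD).
Qed.

Lemma continuous_diagonal_point : continuous diagonal_point.
Proof.
move=> d; apply: (@continuous_comp D (conjugate G * G)%type G set_val snd).
  exact: continuous_diagonal_val.
exact: cvg_snd.
Qed.

Lemma continuous_conjugate_inv : continuous (fun x : conjugate G => (x : G)^-1 : G).
Proof.
apply/continuousP => U oU; exists U => //.
apply/seteqP; split=> [_ [x Ux <-]|x Ux] /=; first by rewrite invgK.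
by exists x^-1 => //; rewrite invgK.
Qed.

(** The two coordinates agree on the diagonal, so the inverse can be read off the first one, where
    inversion is continuous from tau^-1 to tau. *)
Lemma continuous_diagonal_pointV : continuous (fun d => (diagonal_point d)^-1).
Proof.
have -> : (fun d => (diagonal_point d)^-1) = (fun d : D => ((set_val d).1 : G)^-1).
  apply/funext => -[[a b] ab]; have [g _ [ag bg]] := set_mem ab.
  by rewrite /diagonal_point !set_valE /= -ag -bg.
move=> d; apply: (@continuous_comp D (conjugate G) G (fun d => (set_val d).1)
  (fun g => (g : G)^-1)).
  apply: (@continuous_comp D (conjugate G * G)%type (conjugate G) set_val fst).
    exact: continuous_diagonal_val.
  exact: cvg_fst.
exact: continuous_conjugate_inv.
Qed.

End Diagonal.

Theorem proposition3p2 (G : groupWithTopologyType)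
    (hG : paratopological_group G) :
  (weakly_compact_bounded (set_type (conjugate_diagonal G)) ->
     topological_group G /\ weakly_compact_bounded G) /\
  (compact_bounded (set_type (conjugate_diagonal G)) ->
     topological_group G /\ compact_bounded G).
Proof.
have tG : weakly_compact_bounded (set_type (conjugate_diagonal G)) ->
    topological_group G.
  move=> bD; split=> //; exact: (continuous_invg_cover hG.2 (@diagonal_point_surj G)
    (@continuous_diagonal_point G) (@continuous_diagonal_pointV G) bD).
split=> bD.
  split; first exact: tG.
  exact: weakly_compact_bounded_image (@continuous_diagonal_point G) (@diagonal_point_surj G) bD.
split; first exact/tG/compact_bounded_weakly.
exact: compact_bounded_image (@continuous_diagonal_point G) (@diagonal_point_surj G) bD.
Qed.
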